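(* Let $G_{\mathrm x}>0$, $G_{\mathrm y}>0$, $R_{\mathcal X}>0$, $R_{\mathcal Y}>0$ be fixed. Then for any generic LMO-LMO method (see context) running for $T\ge1$ iterations, there exist dimensions $n,m$ with $T\le\min\{m,n\}/4-1$, compact convex sets $\mathcal X\subseteq\mathbb R^n$ and $\mathcal Y\subseteq\mathbb R^m$ with radii $R_{\mathcal X}$ and $R_{\mathcal Y}$ respectively, and a function $f\in\mathcal F^0_{G_{\mathrm x},G_{\mathrm y},\|\cdot\|_2}(\mathcal X,\mathcal Y)$ (together with initial points $x_1\in\mathcal X$, $y_1\in\mathcal Y$ and valid tie-breaking rules for the linear minimization oracles) such that the output $(\bar x_T,\bar y_T)$ of the method satisfies $$\max_{y\in\mathcal Y}f(\bar x_T,y)-\min_{x\in\mathcal X}f(x,\bar y_T)\ \ge\ \frac{G_{\mathrm x}R_{\mathcal X}}{2(T+1)^{1/2}}+\frac{G_{\mathrm y}R_{\mathcal Y}}{2(T+1)^{1/2}}.$$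
   Context: For compact convex $\mathcal U$, $\mathrm{LMO}_{\mathcal U}(d)$ returns an element of $\arg\min_{v\in\mathcal U}d^\top v$. A compact convex set $\mathcal U$ has radius $R$ if $\max_{u\in\mathcal U}\|u\|_2=R$. $\mathcal F^0_{G_{\mathrm x},G_{\mathrm y},\|\cdot\|_2}(\mathcal X,\mathcal Y)$ is the class of payoff functions $f$ of saddle-point problems $\min_{x\in\mathcal X}\max_{y\in\mathcal Y}f(x,y)$ that are convex in $x$ and concave in $y$ and satisfy, for all $x,x'\in\mathcal X$ and $y,y'\in\mathcal Y$, $|f(x,y)-f(x',y)|\le G_{\mathrm x}\|x-x'\|_2$ and $|f(x,y)-f(x,y')|\le G_{\mathrm y}\|y-y'\|_2$. Generic LMO-LMO method: given $x_1\in\mathcal X$, $y_1\in\mathcal Y$, for $t=1,\dots,T$ it constructs some (arbitrary) $(p_t,q_t)\in\mathbb R^n\times\mathbb R^m$ and sets $x_{t+1}=\mathrm{LMO}_{\mathcal X}(p_t)$, $y_{t+1}=\mathrm{LMO}_{\mathcal Y}(-q_t)$. It outputs some $\bar x_T\in\mathrm{conv}(\{x_1,\dots,x_{T+1}\})$ and $\bar y_T\in\mathrm{conv}(\{y_1,\dots,y_{T+1}\})$. A method is defined in all dimensions and for all problem instances. Worst-case oracle model: the adversary may choose the feasible sets $\mathcal X,\mathcal Y$, the initial points $x_1,y_1$ (in particular, extreme points), the payoff $f$, and a valid tie-breaking rule for the LMOs (in particular, one always returning extreme-point minimizers). *)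

(* Defs.v *)
From HB Require Import structures.
From mathcomp Require Import all_boot all_order all_algebra.
From mathcomp Require Import all_classical all_reals all_analysis.

Set Implicit Arguments.
Unset Strict Implicit.
Unset Printing Implicit Defensive.

Import Order.TTheory GRing.Theory Num.Theory.
Import numFieldNormedType.Exports.

Local Open Scope classical_set_scope.
Local Open Scope ring_scope.

Definition dotv (R : realType) (n : nat) (d v : 'rV[R]_n) : R :=
  \sum_i d ord0 i * v ord0 i.

(* The library norm on ['rV[R]_n] is the sup norm, hence this definition. *)
Definition norm2 (R : realType) (n : nat) (v : 'rV[R]_n) : R :=
  Num.sqrt (\sum_i v ord0 i ^+ 2).

Definition is_max (R : realType) (A : set R) (a : R) : Prop :=
  A a /\ ubound A a.

Definition is_min (R : realType) (A : set R) (a : R) : Prop :=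
  A a /\ lbound A a.

Definition has_radius (R : realType) (n : nat) (U : set 'rV[R]_n) (r : R) :
    Prop :=
  is_max [set norm2 u | u in U] r.

(* [lmo] is a linear minimization oracle over [U]; its values on ties encode a
   tie-breaking rule. *)
Definition is_lmo (R : realType) (n : nat) (U : set 'rV[R]_n)
    (lmo : 'rV[R]_n -> 'rV[R]_n) : Prop :=
  forall d, U (lmo d) /\ forall v, U v -> dotv d (lmo d) <= dotv d v.

Definition conv_hull (R : realType) (n : nat) (s : seq 'rV[R]_n) :
    set 'rV[R]_n :=
  smallest (@convex_set R 'rV[R]_n) [set` s].

(* The class F^0_{Gx,Gy,||.||_2}(X,Y).  Payoffs are total functions, of which
   only the values on [X] x [Y] are constrained. *)
Definition payoff_class (R : realType) (Gx Gy : R) (n m : nat)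
    (X : set 'rV[R]_n) (Y : set 'rV[R]_m) (f : 'rV[R]_n -> 'rV[R]_m -> R) :
    Prop :=
  [/\ forall y, Y y -> convex_function X (fun x => f x y),
      forall x, X x -> convex_function Y (fun y => - f x y),
      forall x x' y, X x -> X x' -> Y y ->
        `|f x y - f x' y| <= Gx * norm2 (x - x')
    & forall x y y', X x -> Y y -> Y y' ->
        `|f x y - f x y'| <= Gy * norm2 (y - y')].

(* Everything chosen by the adversary. *)
Record instance (R : realType) (n m : nat) := Instance {
  feasX : set 'rV[R]_n;
  feasY : set 'rV[R]_m;
  payoff : 'rV[R]_n -> 'rV[R]_m -> R;
  initx : 'rV[R]_n;
  inity : 'rV[R]_m;
  lmoX : 'rV[R]_n -> 'rV[R]_n;
  lmoY : 'rV[R]_m -> 'rV[R]_m;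
  feasX_compact : compact feasX;
  feasY_compact : compact feasY;
  feasX_convex : @convex_set R 'rV[R]_n feasX;
  feasY_convex : @convex_set R 'rV[R]_m feasY;
  initx_in : feasX initx;
  inity_in : feasY inity;
  lmoX_valid : is_lmo feasX lmoX;
  lmoY_valid : is_lmo feasY lmoY
}.

(* [:: (x_1, y_1); ...; (x_(t+1), y_(t+1))], where [dir] maps the iterates
   available at a given iteration to the pair (p, q) used in that iteration. *)
Fixpoint iterates (R : realType) (n m : nat) (I : instance R n m)
    (dir : seq ('rV[R]_n * 'rV[R]_m) -> 'rV[R]_n * 'rV[R]_m) (t : nat) :
    seq ('rV[R]_n * 'rV[R]_m) :=
  if t is t'.+1 then
    let h := iterates I dir t' in
    let pq := dir h in
    rcons h (lmoX I pq.1, lmoY I (- pq.2))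
  else [:: (initx I, inity I)].

(* A generic LMO-LMO method run for [T] iterations.  The directions may depend
   arbitrarily on the whole instance, oracles included, and on all previous
   iterates; the output is an arbitrary point of the hulls of the iterates. *)
Record lmo_method (R : realType) (T : nat) := LmoMethod {
  direction : forall n m : nat, instance R n m ->
    seq ('rV[R]_n * 'rV[R]_m) -> 'rV[R]_n * 'rV[R]_m;
  outx : forall n m : nat, instance R n m -> 'rV[R]_n;
  outy : forall n m : nat, instance R n m -> 'rV[R]_m;
  outx_hull : forall (n m : nat) (I : instance R n m),
    conv_hull (unzip1 (iterates I (direction I) T)) (outx I);
  outy_hull : forall (n m : nat) (I : instance R n m),
    conv_hull (unzip2 (iterates I (direction I) T)) (outy I)
}.

(* Main.v *)
(** Take both feasible sets to be scaled simplices [conv {r e_1, ..., r e_n}]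
    in dimension [n = 4 (T + 1)], oracles that always return a vertex, and the
    separable payoff [f x y = Gx ||x|| - Gy ||y||].  The outputs are then
    combinations of at most [T + 1] vertices, hence have norm at least
    [r / sqrt (T + 1)], whereas the barycenter of the simplex has norm
    [r / sqrt n = r / (2 sqrt (T + 1))].  The duality gap is the sum of these
    two norm differences, weighted by [Gx] and [Gy]. *)

Require Import Defs.
From mathcomp Require Import all_boot all_order all_algebra.
From mathcomp Require Import all_classical all_reals all_analysis.
From mathcomp Require Import ring lra.

Import Order.TTheory GRing.Theory Num.Theory.
Import numFieldNormedType.Exports.

Local Open Scope classical_set_scope.
Local Open Scope ring_scope.

(** * Euclidean norm: Cauchy-Schwarz, Lipschitz continuity, convexity, and a lower bound from small
    support *)

Section Norm2.
Context {R : realType} {n : nat}.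
Implicit Types u v w : 'rV[R]_n.

Lemma sumsq_ge0 v : 0 <= \sum_i v ord0 i ^+ 2.
Proof. by apply: sumr_ge0 => i _; exact: sqr_ge0. Qed.

Lemma norm2_ge0 v : 0 <= norm2 v.
Proof. exact: sqrtr_ge0. Qed.

Lemma sqr_norm2 v : norm2 v ^+ 2 = \sum_i v ord0 i ^+ 2.
Proof. by rewrite sqr_sqrtr ?sumsq_ge0. Qed.

Lemma norm2Z (a : R) v : norm2 (a *: v) = `|a| * norm2 v.
Proof.
rewrite /norm2 -sqrtr_sqr -sqrtrM ?sqr_ge0// mulr_sumr.
by congr Num.sqrt; apply: eq_bigr => i _; rewrite mxE exprMn.
Qed.

Lemma norm2_eq0 v : norm2 v = 0 -> v = 0.
Proof.
move=> v0; apply/rowP => i; rewrite mxE; apply/eqP; rewrite -sqrf_eq0.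
have /psumr_eq0P H : \sum_i v ord0 i ^+ 2 = 0 by rewrite -sqr_norm2 v0 expr0n.
by rewrite H// => j _; exact: sqr_ge0.
Qed.

(** For nonzero vectors, the squared norm of [norm2 v *: u - norm2 u *: v] is nonnegative and
    factors as a positive multiple of the difference of the two sides. *)
Lemma cauchy_schwarz u v : \sum_i u ord0 i * v ord0 i <= norm2 u * norm2 v.
Proof.
have [/norm2_eq0 ->|u0] := eqVneq (norm2 u) 0.
  by rewrite big1 ?mulr_ge0 ?norm2_ge0// => i _; rewrite mxE mul0r.
have [/norm2_eq0 ->|v0] := eqVneq (norm2 v) 0.
  by rewrite big1 ?mulr_ge0 ?norm2_ge0// => i _; rewrite mxE mulr0.
have uv_gt0 : 0 < norm2 u * norm2 v.
  by rewrite lt_neqAle eq_sym mulf_neq0 ?mulr_ge0 ?norm2_ge0.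
have := sumsq_ge0 (norm2 v *: u - norm2 u *: v).
have -> : \sum_i (norm2 v *: u - norm2 u *: v) ord0 i ^+ 2 =
    2 * (norm2 u * norm2 v) *
    (norm2 u * norm2 v - \sum_i u ord0 i * v ord0 i).
  transitivity (norm2 v ^+ 2 * \sum_i u ord0 i ^+ 2 +
      norm2 u ^+ 2 * \sum_i v ord0 i ^+ 2 -
      2 * (norm2 u * norm2 v) * \sum_i u ord0 i * v ord0 i); last first.
    by rewrite -!sqr_norm2; ring.
  rewrite !mulr_sumr -big_split -sumrB; apply: eq_bigr => i _.
  by rewrite !mxE /=; ring.
by rewrite pmulr_rge0 ?subr_ge0// mulr_gt0.
Qed.

Lemma norm2_triangle u v : norm2 (u + v) <= norm2 u + norm2 v.
Proof.
rewrite -ler_sqr ?nnegrE ?addr_ge0 ?norm2_ge0// sqr_norm2 sqrrD !sqr_norm2.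
have -> : \sum_i (u + v) ord0 i ^+ 2 = \sum_i u ord0 i ^+ 2 +
    (\sum_i u ord0 i * v ord0 i) *+ 2 + \sum_i v ord0 i ^+ 2.
  rewrite -sumrMnl -!big_split; apply: eq_bigr => i _.
  by rewrite mxE sqrrD.
by rewrite lerD2r lerD2l lerMn2r cauchy_schwarz.
Qed.

Lemma norm2_lipschitz u v : `|norm2 u - norm2 v| <= norm2 (u - v).
Proof.
have sub w w' : norm2 w - norm2 w' <= norm2 (w - w').
  by rewrite lerBlDr -[X in norm2 X <= _](subrK w') norm2_triangle.
rewrite ler_norml sub andbT lerNl opprB (le_trans (sub v u))//.
by rewrite -opprB -scaleN1r norm2Z normrN1 mul1r.
Qed.

Lemma convex_norm2D (D : set 'rV[R]_n) (a b : R) : 0 <= a ->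
  convex_function D (fun v => a * norm2 v + b).
Proof.
move=> a0 t u v _ _.
have -> : conv t (a * norm2 u + b : R^o) (a * norm2 v + b) =
    a * (t%:num * norm2 u + (1 - t%:num) * norm2 v) + b.
  by rewrite convRE /unstable.onem; ring.
rewrite lerD2r ler_wpM2l// (le_trans (norm2_triangle _ _))//.
by rewrite !norm2Z !ger0_norm// subr_ge0.
Qed.

(* Summing [v_i^2 >= 2 c v_i - c^2] over the support, with [c = r / k]. *)
Lemma norm2_ge_support (S : {set 'I_n}) (k : nat) (r : R) v :
    0 <= r -> (0 < k)%N -> (#|S| <= k)%N ->
    (forall i, i \notin S -> v ord0 i = 0) -> \sum_i v ord0 i = r ->
  r / Num.sqrt k%:R <= norm2 v.
Proof.
move=> r0 k0 Sk vS vr; have kR : 0 < k%:R :> R by rewrite ltr0n.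
rewrite -ler_sqr ?nnegrE ?divr_ge0 ?sqrtr_ge0 ?norm2_ge0//.
rewrite expr_div_n sqr_sqrtr ?(ltW kR)// sqr_norm2.
pose c := r / k%:R.
have : \sum_(i in S) (2 * c * v ord0 i - c ^+ 2) <= \sum_i v ord0 i ^+ 2.
  rewrite [leRHS](bigID (mem S))/= ler_wpDr ?sumr_ge0//.
    by move=> i _; exact: sqr_ge0.
  by apply: ler_sum => i _; have := sqr_ge0 (v ord0 i - c); nra.
move=> le_sum; apply: le_trans le_sum; rewrite sumrB -mulr_sumr sumr_const.
have -> : \sum_(i in S) v ord0 i = r.
  by rewrite -vr [RHS](bigID (mem S))/= [X in _ + X]big1 ?addr0.
(* The choice of [c] maximizes the right-hand side. It has [k] copies of [c ^+ 2] where the sum has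
   only [#|S| <= k], which gives the inequality. *)
have -> : r ^+ 2 / k%:R = 2 * c * r - c ^+ 2 *+ k.
  by rewrite -mulr_natr /c; field; rewrite lt0r_neq0.
by rewrite lerB// ler_wpMn2l// sqr_ge0.
Qed.

End Norm2.

(** * The scaled simplex: compactness, oracle, radius, and norms of its points *)

Section Simplex.
Context {R : realType} {n : nat}.
Implicit Types (v d : 'rV[R]_n.+1) (r : R) (i : 'I_n.+1).

Definition vertex r i : 'rV[R]_n.+1 := \row_j (r *+ (j == i)).

Definition simplex r : set 'rV[R]_n.+1 :=
  [set v | (forall i, 0 <= v ord0 i) /\ \sum_i v ord0 i = r].

(** The oracle answers with a vertex even on ties. The successor dimension supplies the default
    index [ord0] for the argmin. *)
Definition simplex_lmo r d : 'rV[R]_n.+1 :=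
  vertex r [arg min_(i < ord0) d ord0 i]%O.

Lemma sum_vertex r i : \sum_j vertex r i ord0 j = r.
Proof.
rewrite (bigD1 i)//= big1 ?addr0 ?mxE ?eqxx// => j /negPf ji.
by rewrite mxE ji.
Qed.

Lemma simplex_vertex r i : 0 <= r -> simplex r (vertex r i).
Proof. by move=> r0; split=> [j|]; rewrite ?sum_vertex// mxE mulrn_wge0. Qed.

Lemma simplex_coord_le r v i : simplex r v -> v ord0 i <= r.
Proof. by case=> v0 <-; rewrite (bigD1 i)//= lerDl sumr_ge0. Qed.

Lemma simplex_convex r : @convex_set R 'rV[R]_n.+1 (simplex r).
Proof.
move=> u v t /set_mem[u0 ur] /set_mem[v0 vr]; apply/mem_set; split.
  by move=> i; rewrite !mxE addr_ge0// mulr_ge0// subr_ge0.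
transitivity (t%:num * r + (1 - t%:num) * r); last by ring.
rewrite -{1}ur -vr !mulr_sumr -big_split.
by apply: eq_bigr => i _; rewrite !mxE.
Qed.

(** The simplex is a closed subset of a compact box: it is an intersection of closed half-spaces and
    a hyperplane. *)
Lemma simplex_compact r : compact (simplex r).
Proof.
have box_compact := @rV_compact R n.+1 (fun=> `[0, r]%classic)
  (fun=> @segment_compact R 0 r).
apply: subclosed_compact box_compact _.
- have -> : simplex r =
      \bigcap_i [set v | 0 <= v ord0 i] `&` [set v | \sum_i v ord0 i = r].
    apply/seteqP; split=> v [v0 vr]; split=> // i; first by move=> _; exact: v0.
    exact: (v0 i I).
  apply: closedI.
    apply: closed_bigI => i _.
    apply: (@preimage_closed _ _ (fun v => v ord0 i) [set x | 0 <= x]).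
      by move=> v _; exact: coord_continuous.
    exact: closed_ge.
  apply: (@preimage_closed _ _ (fun v => \sum_i v ord0 i) [set x | x = r]).
    move=> v _; elim: (index_enum _) => [|i s IH].
      under eq_fun do rewrite big_nil; exact: cst_continuous.
    under eq_fun do rewrite big_cons.
    exact: (continuousD (@coord_continuous R 1 n.+1 ord0 i v) IH).
  exact: closed_eq.
- move=> v vr i /=; rewrite in_itv/= (simplex_coord_le _ _ _ vr) andbT.
  by case: vr.
Qed.

Lemma simplex_lmo_valid r : 0 <= r -> is_lmo (simplex r) (simplex_lmo r).
Proof.
move=> r0 d; split; first exact: simplex_vertex.
move=> v [v0 vr]; rewrite /simplex_lmo.
case: arg_minP => // i _ dmin.
(* Since [v] has total mass [r], the value [r * d_i] at the vertex can be spread over the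
   coordinates of [v] and compared term by term. *)
have -> : dotv d (vertex r i) = \sum_j d ord0 i * v ord0 j.
  rewrite -mulr_sumr vr /dotv (bigD1 i)//= big1 ?addr0 ?mxE ?eqxx//.
  by move=> j /negPf ji; rewrite mxE ji mulr0.
by apply: ler_sum => j _; rewrite ler_wpM2r// dmin.
Qed.

(** A vertex attains the value; the upper bound sums [v_i ^+ 2 <= v_i * r]. *)
Lemma simplex_radius r : 0 <= r -> has_radius (simplex r) r.
Proof.
move=> r0; split.
  exists (vertex r ord0); first exact: simplex_vertex.
  rewrite /norm2 (bigD1 ord0)//= big1 ?addr0 => [|j /negPf j0].
    by rewrite mxE eqxx sqrtr_sqr ger0_norm.
  by rewrite mxE j0 expr0n.
move=> _ [v vr <-].
rewrite -ler_sqr ?nnegrE ?norm2_ge0// sqr_norm2 expr2.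
rewrite -{1}(proj2 vr) mulr_suml; apply: ler_sum => i _.
by rewrite expr2 ler_wpM2l ?(proj1 vr)// simplex_coord_le.
Qed.

(** The barycenter attains the value; the lower bound is the support estimate with all indices as
    support. *)
Lemma simplex_norm2_min r : 0 <= r ->
  is_min [set norm2 v | v in simplex r] (r / Num.sqrt n.+1%:R).
Proof.
move=> r0; split.
  have nR : 0 < n.+1%:R :> R by rewrite ltr0n.
  exists (const_mx (r / n.+1%:R)).
    split=> [i|]; first by rewrite mxE divr_ge0.
    rewrite (eq_bigr (fun=> r / n.+1%:R)) => [|i _]; last by rewrite mxE.
    by rewrite sumr_const card_ord -(mulr_natr (r / _)) divfK// lt0r_neq0.
  have -> : norm2 (const_mx (r / n.+1%:R) : 'rV[R]_n.+1) =
      Num.sqrt (r ^+ 2 / n.+1%:R).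
    congr Num.sqrt; rewrite (eq_bigr (fun=> (r / n.+1%:R) ^+ 2)) => [|i _].
      rewrite sumr_const card_ord -(mulr_natr (_ ^+ 2)); field.
      by rewrite addrC natr1 lt0r_neq0.
    by rewrite mxE.
  by rewrite sqrtrM ?sqr_ge0// sqrtr_sqr ger0_norm// sqrtrV// ltW.
move=> _ [v [_ vr] <-].
apply: (norm2_ge_support [set: _]%SET); rewrite ?cardsT ?card_ord// => i.
by rewrite inE.
Qed.

Lemma conv_hull_vertices_norm2 r (l : seq 'I_n.+1) v :
    0 <= r -> (0 < size l)%N -> conv_hull (map (vertex r) l) v ->
  r / Num.sqrt (size l)%:R <= norm2 v.
Proof.
move=> r0 l0 vl.
(* Both properties are preserved by convex combinations and hold at the listed vertices, so they
   pass to the hull. Repetitions in [l] only shrink the support. *)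
have [vr vS] : \sum_i v ord0 i = r /\ (forall i, i \notin l -> v ord0 i = 0).
  move: v vl; apply: smallest_sub => [u v t /set_mem[ur ul] /set_mem[vr vl]|].
    apply/mem_set; split=> [|i il]; last first.
      by rewrite !mxE ul// vl// !mulr0 addr0.
    transitivity (t%:num * r + (1 - t%:num) * r); last by ring.
    rewrite -{1}ur -vr !mulr_sumr -big_split.
    by apply: eq_bigr => i _; rewrite !mxE.
  move=> _ /mapP[i il ->]; split=> [|j jl]; first exact: sum_vertex.
  by rewrite mxE; case: eqP jl il => // -> /negP.
apply: (norm2_ge_support [set i in l]%SET) => //.
  by rewrite cardsE card_size.
by move=> i; rewrite inE => /vS.
Qed.

End Simplex.

(** * The hard instance, its iterates, and its two inner optimization problems *)

Section HardInstance.
Context {R : realType} {n m : nat}.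
Variables (Gx Gy RX RY : R).
Hypotheses (Gx0 : 0 <= Gx) (Gy0 : 0 <= Gy) (RX0 : 0 <= RX) (RY0 : 0 <= RY).

Definition hard_payoff (x : 'rV[R]_n.+1) (y : 'rV[R]_m.+1) : R :=
  Gx * norm2 x - Gy * norm2 y.

Definition hard_instance : instance R n.+1 m.+1 := Instance hard_payoff
  (simplex_compact RX) (simplex_compact RY)
  (simplex_convex RX) (simplex_convex RY)
  (simplex_vertex _ ord0 RX0) (simplex_vertex _ ord0 RY0)
  (simplex_lmo_valid _ RX0) (simplex_lmo_valid _ RY0).

Lemma hard_payoff_class X Y : payoff_class Gx Gy X Y hard_payoff.
Proof.
split.
- by move=> y _; exact: convex_norm2D.
- move=> x _; rewrite (_ : (fun y => _) = (fun y => Gy * norm2 y + - (Gx * norm2 x))).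
    exact: convex_norm2D.
  by apply/funext => y; rewrite opprB.
- move=> x x' y _ _ _; rewrite /hard_payoff opprB addrA subrK -mulrBr.
  by rewrite normrM ger0_norm// ler_wpM2l// norm2_lipschitz.
- move=> x y y' _ _ _; rewrite /hard_payoff opprB addrC addrA subrK -mulrBr.
  by rewrite normrM ger0_norm// ler_wpM2l// distrC norm2_lipschitz.
Qed.

(** Whatever the directions are, the initial points and all oracle answers are vertices, so each
    iteration reveals at most one new coordinate per player. *)
Lemma iterates_hard_instance dir t :
  exists2 l : seq ('I_n.+1 * 'I_m.+1), size l = t.+1 &
    iterates hard_instance dir t =
    [seq (vertex RX i.1, vertex RY i.2) | i <- l].
Proof.
elim: t => [|t [l lt IH]]; first by exists [:: (ord0, ord0)].
set pq := dir (iterates hard_instance dir t).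
exists (rcons l ([arg min_(i < ord0) pq.1 ord0 i]%O,
                 [arg min_(i < ord0) (- pq.2) ord0 i]%O)).
  by rewrite size_rcons lt.
by rewrite map_rcons -IH.
Qed.

(** By separability the best response ignores [x]: it is the point of the simplex of least norm. *)
Lemma hard_payoff_max (x : 'rV[R]_n.+1) :
  is_max [set hard_payoff x y | y in simplex RY]
    (Gx * norm2 x - Gy * (RY / Num.sqrt m.+1%:R)).
Proof.
have [[y yY <-] ymin] := simplex_norm2_min (n := m) RY RY0.
split; first by exists y.
by move=> _ [z zY <-]; rewrite lerD2l lerN2 ler_wpM2l// ymin//; exists z.
Qed.

Lemma hard_payoff_min (y : 'rV[R]_m.+1) :
  is_min [set hard_payoff x y | x in simplex RX]
    (Gx * (RX / Num.sqrt n.+1%:R) - Gy * norm2 y).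
Proof.
have [[x xX <-] xmin] := simplex_norm2_min (n := n) RX RX0.
split; first by exists x.
by move=> _ [z zX <-]; rewrite lerD2r ler_wpM2l// xmin//; exists z.
Qed.

End HardInstance.

(** * The lower bound on the duality gap *)

Theorem theorem2 (R : realType) (Gx Gy RX RY : R)
    (hGx : 0 < Gx) (hGy : 0 < Gy) (hRX : 0 < RX) (hRY : 0 < RY)
    (T : nat) (hT : (1 <= T)%N) (A : lmo_method R T) :
  exists (n m : nat) (I : instance R n m),
    [/\ T%:R <= (minn m n)%:R / 4 - 1 :> R,
        has_radius (feasX I) RX,
        has_radius (feasY I) RY,
        payoff_class Gx Gy (feasX I) (feasY I) (payoff I)
      & exists fmax fmin : R,
          [/\ is_max [set payoff I (outx A I) y | y in feasY I] fmax,
              is_min [set payoff I x (outy A I) | x in feasX I] fmin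
            & Gx * RX / (2 * Num.sqrt (T.+1)%:R)
                + Gy * RY / (2 * Num.sqrt (T.+1)%:R) <= fmax - fmin]].
Proof.
have [Gx0 Gy0] := (ltW hGx, ltW hGy); have [RX0 RY0] := (ltW hRX, ltW hRY).
(* The actual dimension is [n.+1 = 4 * T.+1], for which the dimension condition holds with
   equality. *)
pose n := (4 * T + 3)%N.
have nE : n.+1 = (4 * T.+1)%N by rewrite /n -addnS mulnS addnC.
pose I := @hard_instance R n n Gx Gy RX RY RX0 RY0.
exists n.+1, n.+1, I; split.
- by rewrite minnn nE natrM mulrC mulKf// -natr1 addrK.
- exact: simplex_radius.
- exact: simplex_radius.
- exact: hard_payoff_class.
exists (Gx * norm2 (outx A I) - Gy * (RY / Num.sqrt n.+1%:R)),
  (Gx * (RX / Num.sqrt n.+1%:R) - Gy * norm2 (outy A I)).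
split; [exact: hard_payoff_max|exact: hard_payoff_min|].
have [l lT lE] := @iterates_hard_instance R n n Gx Gy RX RY RX0 RY0
  (direction A I) T.
have x_ge : RX / Num.sqrt T.+1%:R <= norm2 (outx A I).
  rewrite -lT -(size_map fst); apply: conv_hull_vertices_norm2 => //.
    by rewrite size_map lT.
  by have := @outx_hull _ _ A _ _ I; rewrite lE /unzip1 -!map_comp.
have y_ge : RY / Num.sqrt T.+1%:R <= norm2 (outy A I).
  rewrite -lT -(size_map snd); apply: conv_hull_vertices_norm2 => //.
    by rewrite size_map lT.
  by have := @outy_hull _ _ A _ _ I; rewrite lE /unzip2 -!map_comp.
(* The factor 4 in the dimension makes the least norm half of the bound on the outputs. *)
have -> : Num.sqrt n.+1%:R = 2 * Num.sqrt T.+1%:R :> R.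
  rewrite nE natrM sqrtrM// (_ : 4%:R = 2 ^+ 2); last by rewrite -natrX.
  by rewrite sqrtr_sqr ger0_norm.
set s := Num.sqrt T.+1%:R in x_ge y_ge *.
have s0 : s != 0 by rewrite lt0r_neq0// sqrtr_gt0 ltr0n.
(* Subtracting the two barycenter terms from the weighted sum leaves
   [r / s - r / (2 * s) = r / (2 * s)] for each player. *)
have := lerD (ler_wpM2l Gx0 x_ge) (ler_wpM2l Gy0 y_ge).
rewrite -(lerD2r (- (Gx * (RX / (2 * s)) + Gy * (RY / (2 * s))))).
congr (_ <= _); last by ring.
by field.
Qed.
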